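(* Let $n\in\mathbb{Z}^+$ and let $S=\{s_1,\dots,s_j\}$ be a finite set of distinct positive integers. Let $C$ be the set of tuples $\mathbf{c}=(c_1,\dots,c_j)$ of nonnegative integers with $\sum_{i=1}^j s_ic_i=n$. Then $$|\mathrm{FR}^{\mathrm{T2}}_{n,S}|=n!\sum_{\mathbf{c}\in C}\binom{\sum_{k=1}^j c_k}{c_1,\dots,c_j}\prod_{i=1}^j (s_i!)^{-c_i}.$$
   Context: A Fubini ranking of length $n$ is a tuple $(b_1,\dots,b_n)\in[n]^n$ that satisfies two conditions. First, some $b_i$ equals $1$. Second, for every value $x$ occurring exactly $k>0$ times, the next larger value occurring in the tuple (if there is one) is $x+k$. For $S\subseteq\mathbb{Z}^+$, $\mathrm{FR}^{\mathrm{T2}}_{n,S}$ is the set of Fubini rankings of length $n$ in which every value that occurs has its number of occurrences in $S$. *)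

(* Defs.v *)
From mathcomp Require Import all_boot.

Set Implicit Arguments.
Unset Strict Implicit.
Unset Printing Implicit Defensive.

(* [y] is the next larger value after [x] among those occurring in [b]. *)
Definition next_value (b : seq nat) (x y : nat) : bool :=
  [&& y \in b, x < y & all (fun z => ~~ (x < z < y)) b].

Definition fubini_ranking (b : seq nat) : bool :=
  [&& all (fun v => 1 <= v <= size b) b,
      1 \in b &
      all (fun x => all (fun y => next_value b x y ==>
                                  (y == x + count_mem x b)) b) b].

(* Entries are kept in their literal range [1, n]: the type 'I_n.+1 allows
   0, ..., n and [fubini_ranking] excludes 0. *)
Definition FR_T2 (n : nat) (S : {pred nat}) : {set n.-tuple 'I_n.+1} :=
  [set b : n.-tuple 'I_n.+1 | fubini_ranking (map val b) &
     all (fun x => count_mem x (map val b) \in S) (map val b)].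

Definition multinomial (c : seq nat) : nat :=
  (sumn c)`! %/ \prod_(x <- c) x`!.

(* The solutions c of \sum_i s_i c_i = n. For positive s_i every solution in
   nonnegative integers has c_i <= n (see [weighted_solutions_complete]), so
   the finite type j.-tuple 'I_n.+1 loses nothing. *)
Definition weighted_solutions (n j : nat) (s : j.-tuple nat) :
    {set j.-tuple 'I_n.+1} :=
  [set c : j.-tuple 'I_n.+1 | \sum_(i < j) tnth s i * tnth c i == n].

Lemma multinomialE (c : seq nat) :
  multinomial c * \prod_(x <- c) x`! = (sumn c)`!.
Proof.
rewrite /multinomial divnK //; elim: c => [|x c IH]; first by rewrite big_nil.
rewrite big_cons /= -(bin_fact (leq_addr (sumn c) x)) addKn.
by rewrite dvdn_mull // dvdn_mul.
Qed.

Lemma weighted_solutions_complete (n j : nat) (s : j.-tuple nat)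
    (s_gt0 : all (fun x => 0 < x) s) (c : j.-tuple nat) :
  \sum_(i < j) tnth s i * tnth c i = n <->
  exists2 d, d \in weighted_solutions n s & map val d = c.
Proof.
split=> [Hc | [d]]; last first.
  rewrite inE => /eqP dn dc; apply: etrans dn; apply: eq_bigr => i _; congr (_ * _).
  by rewrite (tnth_nth 0) -dc (nth_map ord0) ?size_tuple // -tnth_nth.
have c_le i : tnth c i < n.+1.
  rewrite ltnS -Hc (bigD1 i) //=; apply: leq_trans (leq_addr _ _).
  by rewrite leq_pmull // (allP s_gt0) ?mem_tnth.
exists [tuple Ordinal (c_le i) | i < j].
  rewrite inE; apply/eqP; apply: etrans Hc; apply: eq_bigr => i _.
  by rewrite tnth_mktuple.
apply: (@eq_from_nth _ 0); rewrite size_map !size_tuple // => i lt_ij.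
rewrite (nth_map ord0) ?size_tuple // -(tnth_nth ord0 _ (Ordinal lt_ij)).
by rewrite tnth_mktuple /= (tnth_nth 0).
Qed.

(* Main.v *)
Require Import Defs.
From mathcomp Require Import all_boot all_order all_algebra.

Set Implicit Arguments.
Unset Strict Implicit.

(** A nonempty tuple is a Fubini ranking exactly when every entry [v] is one
    more than the number of entries smaller than [v].  In this form, deleting
    the positions of the largest value leaves a Fubini ranking on the other
    positions, with no shift of values; hence the numbers [F n] of rankings
    satisfy [F n = \sum_(k in S) 'C(n, k) * F (n - k)].  The right-hand side
    of the theorem, divided by [n!], satisfies the matching recurrence
    [r n = \sum_(k in S) r (n - k) / k!], which is the Pascal identity for
    multinomial coefficients. *)

(** * Fubini rankings through numbers of smaller entries *)

Lemma count_ltn_next_value {b : seq nat} {x y : nat} :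
  next_value b x y ->
  count (fun w => w < y) b = count (fun w => w < x) b + count_mem x b.
Proof.
case/and3P=> _ lt_xy /allP no_mid.
(* Inclusion-exclusion: no entry is both below [x] and equal to [x]. *)
rewrite -count_predUI [X in _ + X](@eq_count _ _ pred0) ?count_pred0 ?addn0; last first.
  by move=> w /=; case: ltngtP.
apply: eq_in_count => w /no_mid /=.
by case: (ltngtP w x) => [lt_wx|_|->] //=; rewrite ?(ltn_trans lt_wx lt_xy) // => /negbTE.
Qed.

(** Passing from a value to the next one raises both the value and the number of smaller entries by
    the multiplicity of the old value, so the equation propagates upwards from the smallest value
    1. *)
Lemma fubini_rankingE (b : seq nat) :
  fubini_ranking b =
    (0 < size b) && all (fun v => v == (count (fun w => w < v) b).+1) b.
Proof.
apply/idP/andP => [|[b_gt0 /allP rankb]].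
  case/and3P=> /allP b_bd b1 /allP b_next.
  split; first by case: b b1 {b_bd b_next}.
  apply/allP; elim/ltn_ind=> y IHy by_; apply/eqP.
  have [[x0 bx0 lt_x0y]|no_lt] := altP (@hasP _ (fun w => w < y) b); last first.
    have -> : count (fun w => w < y) b = 0.
      by apply/eqP; rewrite -leqn0 leqNgt -has_count.
    have /andP[y_gt0 _] := b_bd y by_.
    apply/eqP; rewrite eqn_leq y_gt0 andbT leqNgt.
    by apply: contra no_lt => lt_1y; apply/hasP; exists 1.
  (* The largest entry below [y] is the value that [y] follows. *)
  pose P := [pred w | (w \in b) && (w < y)].
  have exP : exists w, P w by exists x0; rewrite /= bx0.
  have Pmax w : P w -> w <= y by case/andP=> _ /ltnW.
  case: (ex_maxnP exP Pmax) => x /andP[bx lt_xy] xmax.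
  have nxt : next_value b x y.
    rewrite /next_value by_ lt_xy; apply/allP=> w bw.
    apply/negP=> /andP[lt_xw lt_wy].
    by have := xmax w; rewrite /= bw lt_wy leqNgt lt_xw; move/(_ isT).
  have := b_next x bx => /allP/(_ y by_); rewrite nxt => /eqP {1}->.
  by rewrite (count_ltn_next_value nxt) {1}(eqP (IHy x lt_xy bx)).
apply/and3P; split.
(* An entry [v] is not below itself, so fewer than [size b] entries are below it. *)
- apply/allP=> v bv; rewrite {1}(eqP (rankb v bv)) /= {1}(eqP (rankb v bv)).
  rewrite ltn_neqAle count_size andbT -all_count.
  by apply/allPn; exists v; rewrite // ltnn.
(* Descent reaches a smallest entry; nothing is below it, so it equals 1. *)
- have : exists v, v \in b by case: (b) b_gt0 => // v s _; exists v; rewrite mem_head.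
  case=> v; elim/ltn_ind: v => v IHv bv.
  have [/hasP[w bw lt_wv]|no_lt] := boolP (has (fun w => w < v) b).
    exact: IHv lt_wv bw.
  move: (rankb v bv); rewrite has_count -eqn0Ngt in no_lt.
  by rewrite (eqP no_lt) => /eqP <-.
- apply/allP=> x bx; apply/allP=> y by_; apply/implyP=> nxt.
  by rewrite {1}(eqP (rankb y by_)) {1}(eqP (rankb x bx)) (count_ltn_next_value nxt).
Qed.

(** * Rankings of a set of positions and the removal of the largest value *)

Section Rankings.

Variables (T : finType) (N : nat) (S : {pred nat}).
Implicit Types (A B : {set T}) (f g : {ffun T -> 'I_N.+1}).

(* Rankings of the positions in [A]; positions outside [A] hold the junk
   value 0, so that all these sets live in the same finite type. *)
Definition rankings A : {set {ffun T -> 'I_N.+1}} :=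
  [set f : {ffun T -> 'I_N.+1} | [forall i, if i \in A then
     (f i == (#|[set j in A | f j < f i]|).+1 :> nat) &&
     (#|[set j in A | f j == f i]| \in S) else f i == ord0]].

Definition erase B f : {ffun T -> 'I_N.+1} :=
  [ffun i => if i \in B then ord0 else f i].

Definition top A f : {set T} := [set i in A | [forall j in A, f j <= f i]].

(** The value placed on [B] is the only one that the rank condition allows for a largest block
    [B]. *)
Definition put_top A B f : {ffun T -> 'I_N.+1} :=
  [ffun i => if i \in B then inord #|A :\: B|.+1 else f i].

Lemma rankingsP A f :
  reflect ((forall i, i \in A ->
              f i = (#|[set j in A | f j < f i]|).+1 :> nat /\
              #|[set j in A | f j == f i]| \in S) /\
           (forall i, i \notin A -> f i = ord0))
          (f \in rankings A).
Proof.
rewrite inE; apply: (iffP forallP) => [Hf | [HA HnA] i].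
  split=> i iA; move: (Hf i); first by rewrite iA => /andP[/eqP].
  by rewrite (negbTE iA) => /eqP.
by case: ifPn => iA; [case: (HA i iA) => /eqP -> -> | rewrite HnA].
Qed.

(** Positions of [B] are neither below nor level with those of [A :\: B], so the conditions there do
    not see [B]. On [B] itself, the smaller positions are exactly [A :\: B] and the equal ones
    exactly [B]. *)
Lemma rankings_top_block A B f (v : 'I_N.+1) :
  B \subset A -> B != set0 -> (forall i, i \in B -> f i = v) ->
  (forall i, i \in A :\: B -> f i < v) ->
  (f \in rankings A) =
    [&& erase B f \in rankings (A :\: B), v == #|A :\: B|.+1 :> nat & #|B| \in S].
Proof.
move=> sBA /set0Pn[i0 i0B] fB fD.
have inA j : j \in A = (j \in B) || (j \in A :\: B).
  by rewrite inE; case: (boolP (j \in B)) => //= /(subsetP sBA) ->.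
have eD j : j \in A :\: B -> erase B f j = f j.
  by rewrite inE ffunE => /andP[/negbTE ->].
have ltv : [set j in A | f j < v] = A :\: B.
  apply/setP=> j; rewrite inE inA; case: (boolP (j \in A :\: B)) => [/fD ->|_].
    by rewrite orbT.
  by rewrite orbF; apply/negP=> /andP[/fB->]; rewrite ltnn.
have eqv : [set j in A | f j == v] = B.
  apply/setP=> j; rewrite inE inA; case: (boolP (j \in B)) => [/fB ->|_] /=.
    by rewrite eqxx.
  by apply/negP=> /andP[/fD lt /eqP ev]; rewrite ev ltnn in lt.
have ltD i : i \in A :\: B -> [set j in A | f j < f i] =
    [set j in A :\: B | erase B f j < erase B f i].
  move=> iD; apply/setP=> j; rewrite !inE -in_setD inA (eD i iD).
  case: (boolP (j \in A :\: B)) => [jD|_]; first by rewrite eD // orbT.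
  by rewrite orbF; apply/negP=> /andP[/fB->]; rewrite ltnNge ltnW ?fD.
have eqD i : i \in A :\: B -> [set j in A | f j == f i] =
    [set j in A :\: B | erase B f j == erase B f i].
  move=> iD; apply/setP=> j; rewrite !inE -in_setD inA (eD i iD).
  case: (boolP (j \in A :\: B)) => [jD|_]; first by rewrite eD // orbT.
  by rewrite orbF; apply/negP=> /andP[/fB-> /eqP ev]; move: (fD i iD); rewrite -ev ltnn.
apply/rankingsP/and3P => [[HA HnA]|[/rankingsP[HD HnD] /eqP vE BS]].
  have [] := HA i0 (subsetP sBA _ i0B); rewrite (fB i0 i0B) ltv eqv => /eqP vE BS.
  split=> //; apply/rankingsP; split=> i iD.
    have [|e1 e2] := HA i; first by rewrite inA iD orbT.
    by rewrite -ltD // -eqD // eD.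
  rewrite ffunE; case: ifPn => // iB; apply: HnA.
  by rewrite inA (negbTE iB).
split=> i; rewrite inA.
  case/orP=> [iB|iD]; first by rewrite (fB i iB) ltv eqv.
  by rewrite ltD // eqD // -{1}(eD i iD); apply: HD.
by rewrite negb_or => /andP[iB /HnD]; rewrite ffunE (negbTE iB).
Qed.

Lemma top_block A f : A != set0 ->
  exists v : 'I_N.+1, [/\ top A f != set0,
    forall i, i \in top A f -> f i = v &
    forall i, i \in A :\: top A f -> f i < v].
Proof.
case/set0Pn=> i0 i0A; case: (@arg_maxnP _ i0 (mem A) (fun i => f i)) => // m.
rewrite inE => mA mmax.
have mtop : m \in top A f by rewrite inE mA; apply/forall_inP.
exists (f m); split; first by apply/set0Pn; exists m.
  move=> i; rewrite inE => /andP[iA /forall_inP imax].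
  by apply/val_inj/anti_leq/andP; split; [apply: mmax | apply: imax].
move=> i; rewrite !inE => /andP[]; rewrite negb_and => iN iA.
move: iN; rewrite iA /= => /forall_inPn[k kA].
by rewrite -ltnNge => /leq_trans; apply; apply: mmax.
Qed.

Lemma top_eq A B f (v : 'I_N.+1) :
  B \subset A -> B != set0 -> (forall i, i \in B -> f i = v) ->
  (forall i, i \in A :\: B -> f i < v) -> top A f = B.
Proof.
move=> sBA /set0Pn[i0 i0B] fB fD; apply/setP=> i; rewrite inE.
have [iB|iB] := boolP (i \in B).
  rewrite (subsetP sBA) //=; apply/forall_inP=> k kA; rewrite (fB i) //.
  by have [/fB ->//|kB] := boolP (k \in B); rewrite ltnW // fD // inE kB.
apply/negP=> /andP[iA /forall_inP/(_ i0 (subsetP sBA _ i0B))].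
by rewrite fB // leqNgt fD // inE iB.
Qed.

(** [erase B] and [put_top A B] are inverse bijections between the two sets. *)
Lemma card_rankings_top A B : #|A| <= N -> B \subset A -> B != set0 ->
  #|B| \in S -> #|[set f in rankings A | top A f == B]| = #|rankings (A :\: B)|.
Proof.
move=> leAN sBA Bn0 BS.
(* The forced top value fits into ['I_N.+1], so [inord] does not fall back to its default. *)
have ltDN : #|A :\: B|.+1 < N.+1.
  rewrite ltnS (leq_trans _ leAN) // cardsD (setIidPr sBA) ltn_subrL.
  by rewrite card_gt0 Bn0 (leq_trans _ (subset_leq_card sBA)) // card_gt0.
have A_n0 : A != set0.
  by apply: contraNneq Bn0 => A0; rewrite A0 subset0 in sBA.
rewrite -!sum1_card (reindex_onto (put_top A B) (erase B)) /=.
  apply: eq_bigl => g; rewrite inE.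
  have fB i : i \in B -> put_top A B g i = inord #|A :\: B|.+1.
    by rewrite ffunE => ->.
  have eE : g \in rankings (A :\: B) -> erase B (put_top A B g) = g.
    case/rankingsP=> _ g0; apply/ffunP=> i; rewrite !ffunE.
    by case: (boolP (i \in B)) => // iB; rewrite g0 // in_setD iB.
  have gD i : g \in rankings (A :\: B) -> i \in A :\: B ->
      put_top A B g i < (inord #|A :\: B|.+1 : 'I_N.+1).
    case/rankingsP=> gD _ iD; have [gi _] := gD i iD.
    rewrite ffunE; move: (iD); rewrite inE => /andP[/negbTE-> _].
    (* The inclusion is proper since [i] is not below itself. *)
    rewrite inordK // gi ltnS; apply: proper_card; apply/properP; split.
      by apply/subsetP=> k; rewrite inE => /andP[].
    by exists i => //; rewrite inE ltnn andbF.
  apply/andP/idP => [[/andP[gA /eqP topg] /eqP eg]|gR].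
    have [v [_ vB vD]] := top_block (put_top A B g) A_n0.
    rewrite topg in vB vD.
    by move: gA; rewrite (rankings_top_block sBA Bn0 vB vD) eg => /andP[].
  have gD' i := gD i gR.
  rewrite (rankings_top_block sBA Bn0 fB gD') (top_eq sBA Bn0 fB gD') eE //.
  by rewrite gR inordK // BS !eqxx.
move=> f; rewrite inE => /andP[fA /eqP topf].
have [v [_ vB vD]] := top_block f A_n0; rewrite topf in vB vD.
move: fA; rewrite (rankings_top_block sBA Bn0 vB vD) => /and3P[_ /eqP vE _].
apply/ffunP=> i; rewrite !ffunE; case: (boolP (i \in B)) => // iB.
by rewrite (vB i iB) -vE inord_val.
Qed.

(** Rankings are sorted by their top block [B]; [0 \notin S] keeps the empty block out of the
    sum. *)
Lemma card_rankings_rec A : 0 < #|A| <= N -> 0 \notin S ->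
  #|rankings A| =
    \sum_(B : {set T} | (B \subset A) && (#|B| \in S)) #|rankings (A :\: B)|.
Proof.
case/andP=> A_gt0 leAN S0; have A_n0 : A != set0 by rewrite -card_gt0.
rewrite -sum1_card.
rewrite (partition_big (top A) (fun B : {set T} => (B \subset A) && (#|B| \in S))) /=.
  apply: eq_bigr => B /andP[sBA BS].
  have Bn0 : B != set0 by apply: contraNneq S0 => B0; rewrite -(cards0 T) -B0.
  rewrite -(card_rankings_top leAN sBA Bn0 BS) -sum1_card.
  by apply: eq_bigl => f; rewrite [RHS]inE.
move=> f fA; have sBA : top A f \subset A.
  by apply/subsetP=> i; rewrite inE => /andP[].
have [v [Bn0 vB vD]] := top_block f A_n0.
by move: fA; rewrite (rankings_top_block sBA Bn0 vB vD) sBA => /and3P[].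
Qed.

Lemma card_rankings0 : #|rankings set0| = 1.
Proof.
rewrite -(cards1 ([ffun=> ord0] : {ffun T -> 'I_N.+1})); apply: eq_card => f.
rewrite [in RHS]inE; apply/rankingsP/eqP => [[_ f0]|->].
  by apply/ffunP=> i; rewrite ffunE f0 ?inE.
by split=> i; rewrite ?inE // ffunE.
Qed.

End Rankings.

(** * From tuples to rankings of all positions *)

Lemma count_map_tnth (n N : nat) (b : n.-tuple 'I_N) (p : pred nat) :
  count p (map val b) = #|[set i | p (tnth b i)]|.
Proof.
rewrite count_map -sum1_count big_tuple sum1_card.
by apply: eq_card => i; rewrite [in RHS]inE.
Qed.

Lemma card_FR_T2 (n : nat) (S : {pred nat}) : 0 < n ->
  #|FR_T2 n S| = #|rankings n S [set: 'I_n]|.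
Proof.
move=> n_gt0; rewrite -!sum1_card.
rewrite (reindex_onto (fun b : n.-tuple 'I_n.+1 => [ffun i => tnth b i])
          (fun f : {ffun 'I_n -> 'I_n.+1} => [tuple f i | i < n])) /=; last first.
  by move=> f _; apply/ffunP=> i; rewrite ffunE tnth_mktuple.
apply: eq_bigl => b.
have -> : [tuple [ffun i => tnth b i] i | i < n] = b.
  by apply: eq_from_tnth => i; rewrite tnth_mktuple ffunE.
rewrite eqxx andbT inE fubini_rankingE size_map size_tuple n_gt0 /=.
have allE (p : pred nat) : all p (map val b) = [forall i, p (tnth b i)].
  by rewrite all_map; apply/all_tnthP/forallP.
rewrite !allE.
have ltE i : count (fun w => w < tnth b i) (map val b) =
    #|[set j in setT | [ffun k => tnth b k] j < [ffun k => tnth b k] i]|.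
  by rewrite count_map_tnth; apply: eq_card => k; rewrite !inE !ffunE.
have eqE i : count_mem (val (tnth b i)) (map val b) =
    #|[set j in setT | [ffun k => tnth b k] j == [ffun k => tnth b k] i]|.
  by rewrite count_map_tnth; apply: eq_card => k; rewrite !inE !ffunE.
apply/andP/rankingsP => [[/forallP H1 /forallP H2]|[H _]].
  split=> i; rewrite inE // => _.
  by rewrite -ltE -eqE ffunE; split; [apply/eqP/H1 | apply: H2].
by split; apply/forallP=> i; have [] := H i (in_setT i);
  rewrite -ltE -eqE ffunE // => /eqP.
Qed.

(** * Rational weights of multiplicity vectors and their recurrence *)

Import GRing.Theory.
Local Open Scope ring_scope.

Lemma fact_neq0 (n : nat) : n`!%:R != 0 :> rat.
Proof. by rewrite Num.Theory.pnatr_eq0 -lt0n fact_gt0. Qed.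

Section Weights.

Variables (j : nat) (s : j.-tuple nat).
Hypothesis s_gt0 : all (fun x => 0 < x)%N s.

(** The summand of the theorem at [c]; natural-number coordinates can be lowered without range
    conditions. *)
Definition weight (c : 'I_j -> nat) : rat :=
  (\sum_i c i)%N`!%:R * \prod_i ((c i)`!%:R * (tnth s i)`!%:R ^+ c i)^-1.

(** The bound [N] is separate from [m] so that the recurrence in [m] stays in one index type. *)
Definition weight_sum (N m : nat) : rat :=
  \sum_(c : {ffun 'I_j -> 'I_N.+1} | (\sum_i tnth s i * c i)%N == m)
    weight (fun i => c i).

Lemma eq_weight (c d : 'I_j -> nat) : c =1 d -> weight c = weight d.
Proof.
move=> cd; rewrite /weight; under eq_bigr do rewrite cd.
by congr (_ * _); apply: eq_bigr => i _; rewrite cd.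
Qed.

(** Effect of lowering coordinate [i] by one, used for the plain total ([F] constant 1) and for the
    weighted sum ([F] the parts). *)
Lemma sum_decr (F c : 'I_j -> nat) (i : 'I_j) : (0 < c i)%N ->
  (\sum_k F k * (c k - (k == i)) + F i = \sum_k F k * c k)%N.
Proof.
move=> ci; rewrite (bigD1 i) //= [RHS](bigD1 i) //= eqxx addnAC -mulnSr subn1 prednK //.
by congr addn; apply: eq_bigr => k /negbTE->; rewrite subn0.
Qed.

Lemma weight_decr (c : 'I_j -> nat) (i : 'I_j) : (0 < c i)%N ->
  (tnth s i)`!%:R^-1 * weight (fun k => c k - (k == i))%N =
  (c i)%:R * ((\sum_k c k).-1`!%:R *
     \prod_k ((c k)`!%:R * (tnth s k)`!%:R ^+ c k)^-1).
Proof.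
move=> ci.
have -> : (\sum_k c k).-1 = (\sum_k (c k - (k == i)))%N.
  have := @sum_decr (fun=> 1%N) c i ci.
  by rewrite -!big_distrr /= !mul1n addn1 => <-.
rewrite /weight; set Q := (\sum_k _)%N`!%:R.
rewrite (bigD1 i) //= [in RHS](bigD1 i) //= eqxx subn1.
under eq_bigr => k /negbTE ki do rewrite ki subn0.
set P := \prod_(k < j | _) _.
case: (c i) ci => // m _; rewrite factS natrM exprS /=.
have m1 : m.+1%:R != 0 :> rat by rewrite Num.Theory.pnatr_eq0.
rewrite !invfM.
rewrite [RHS]mulrCA [LHS]mulrCA; congr (_ * _).
rewrite !mulrA mulfV // mul1r.
by congr (_ * _); rewrite -!mulrA mulrCA.
Qed.

(** By [weight_decr] the terms differ only in the factor [c i]; these factors add up to the total of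
    [c], which turns the factorial of the total minus one into that of the total. *)
Lemma weight_pascal (c : 'I_j -> nat) : (0 < \sum_k c k)%N ->
  weight c = \sum_(i | (0 < c i)%N)
    (tnth s i)`!%:R^-1 * weight (fun k => c k - (k == i))%N.
Proof.
move=> c_gt0; rewrite (eq_bigr _ (@weight_decr c)) -mulr_suml.
have -> : \sum_(i | (0 < c i)%N) (c i)%:R = (\sum_i c i)%:R :> rat.
  rewrite natr_sum big_mkcond; apply: eq_bigr => i _.
  by case: posnP => // ->.
rewrite mulrA -natrM /weight.
by case: (\sum_k c k)%N c_gt0 => // m _; rewrite factS.
Qed.

Lemma weight_sum0 (N : nat) : weight_sum N 0 = 1.
Proof.
rewrite /weight_sum (big_pred1 [ffun=> ord0]) => [|c /=].
  by rewrite /weight !big1 ?mulr1 // => i _; rewrite ffunE.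
rewrite sum_nat_eq0; apply/forall_inP/eqP => [c0|-> i _].
  apply/ffunP=> i; rewrite ffunE; apply: val_inj; apply/eqP.
  have := c0 i isT; rewrite muln_eq0 => /orP[] // /eqP si0.
  by move/allP: s_gt0 => /(_ _ (mem_tnth i s)); rewrite si0.
by rewrite ffunE muln0.
Qed.

(** Lowering coordinate [i] maps solutions for [m] with [c i] positive bijectively to solutions for
    [m - tnth s i]; there are none of the former when the part exceeds [m]. *)
Lemma weight_sum_shift (N m : nat) (i : 'I_j) : (m <= N)%N ->
  \sum_(c : {ffun 'I_j -> 'I_N.+1} |
         ((\sum_k tnth s k * c k)%N == m) && (0 < c i)%N)
     weight (fun k => c k - (k == i))%N =
  if (tnth s i <= m)%N then weight_sum N (m - tnth s i) else 0.
Proof.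
move=> le_mN; case: leqP => [le_sm|lt_ms]; last first.
  apply: big_pred0 => c; apply/negP=> /andP[/eqP cm ci].
  have := @sum_decr (tnth s) (fun k => c k) i ci; rewrite cm => e.
  by move: lt_ms; rewrite -e ltnNge leq_addl.
pose up (d : {ffun 'I_j -> 'I_N.+1}) : {ffun 'I_j -> 'I_N.+1} :=
  [ffun k => inord (d k + (k == i))].
pose down (c : {ffun 'I_j -> 'I_N.+1}) : {ffun 'I_j -> 'I_N.+1} :=
  [ffun k => inord (c k - (k == i))].
have downE c k : down c k = (c k - (k == i))%N :> nat.
  by rewrite ffunE inordK // ltnS (leq_trans (leq_subr _ _)) // -ltnS.
rewrite (reindex_onto up down) /= => [|c /andP[_ ci]]; last first.
  apply/ffunP=> k; apply: val_inj; rewrite ffunE downE subnK ?inord_val //.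
  by case: eqP => // ->.
have si_gt0 k : (0 < tnth s k)%N by rewrite (allP s_gt0) ?mem_tnth.
have upE (d : {ffun 'I_j -> 'I_N.+1}) :
    (\sum_k tnth s k * d k)%N = (m - tnth s i)%N ->
    forall k, up d k = (d k + (k == i))%N :> nat.
  move=> dm k; rewrite ffunE inordK // ltnS.
  case: (eqVneq k i) => [->|_]; last by rewrite addn0 -ltnS.
  (* The raised coordinate stays in range: [d i + 1] is at most [tnth s i * (d i + 1)], hence at
     most [m]. *)
  rewrite addn1 (leq_trans _ le_mN) //.
  have : (tnth s i * d i <= m - tnth s i)%N by rewrite -dm (bigD1 i) //= leq_addr.
  rewrite leq_subRL // -mulnS; apply: leq_trans.
  by rewrite leq_pmull.
have downK (d : {ffun 'I_j -> 'I_N.+1}) :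
    (\sum_k tnth s k * d k)%N = (m - tnth s i)%N -> down (up d) = d.
  by move=> dm; apply/ffunP=> k; apply: val_inj; rewrite /= downE upE // addnK.
have sumE (c : {ffun 'I_j -> 'I_N.+1}) : (0 < c i)%N ->
    ((\sum_k tnth s k * down c k)%N + tnth s i = \sum_k tnth s k * c k)%N.
  move=> ci; rewrite -(@sum_decr (tnth s) (fun k => c k) i ci); congr addn.
  by apply: eq_bigr => k _; rewrite downE.
have condE (d : {ffun 'I_j -> 'I_N.+1}) :
    [&& (\sum_k tnth s k * up d k)%N == m, (0 < up d i)%N & down (up d) == d] =
    ((\sum_k tnth s k * d k)%N == (m - tnth s i)%N).
  apply/and3P/eqP => [[/eqP um ui /eqP du]|dm].
    by rewrite -um -(sumE _ ui) addnK du.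
  have ui : (0 < up d i)%N by rewrite upE // eqxx addn1.
  by rewrite ui -(sumE _ ui) downK // dm subnK ?eqxx.
under eq_bigl => d do rewrite -andbA condE.
by apply: eq_bigr => d /eqP dm; apply: eq_weight => k; rewrite upE // addnK.
Qed.

Lemma weight_sum_rec (N m : nat) : (0 < m <= N)%N ->
  weight_sum N m = \sum_(k <- s | (k <= m)%N) k`!%:R^-1 * weight_sum N (m - k).
Proof.
case/andP=> m_gt0 le_mN; rewrite {1}/weight_sum.
under eq_bigr => c /eqP cm.
  (* A zero total would make every coordinate, and hence [m], zero. *)
  rewrite weight_pascal; last first.
    rewrite lt0n; apply: contraTneq m_gt0 => /eqP; rewrite sum_nat_eq0 => /forall_inP c0.
    by rewrite -cm big1 // => i _; rewrite (eqP (c0 i isT)) muln0.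
  over.
rewrite (exchange_big_dep xpredT) //= big_tuple [RHS]big_mkcond.
apply: eq_bigr => i _; rewrite -mulr_sumr weight_sum_shift //.
by case: ifP; rewrite ?mulr0.
Qed.

End Weights.

(** * Matching the two recurrences and the closed formula *)

Lemma sum_card_mem (T : finType) (P : pred {set T}) (s : seq nat)
    (F : {set T} -> rat) : uniq s ->
  \sum_(B : {set T} | P B && (#|B| \in s)) F B =
  \sum_(k <- s) \sum_(B : {set T} | P B && (#|B| == k)) F B.
Proof.
move=> s_uniq; rewrite [RHS](exchange_big_dep P) /= => [|k B _ /andP[]//].
rewrite big_mkcondr; apply: eq_bigr => B PB.
under eq_bigl do rewrite PB /=.
(* Each [B] is counted as often as its size occurs in [s], at most once by [uniq s]. *)
rewrite big_const_seq iter_addr_0 (@eq_count _ _ (pred1 #|B|)) => [|k].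
  by rewrite count_uniq_mem //; case: (_ \in s).
by rewrite /= eq_sym.
Qed.

Lemma card_rankings (T : finType) (N j : nat) (s : j.-tuple nat) :
  uniq s -> all (fun x => 0 < x)%N s -> forall A : {set T}, (#|A| <= N)%N ->
  #|rankings N (mem s) A|%:R = #|A|`!%:R * weight_sum s N #|A|.
Proof.
move=> s_uniq s_gt0 A; have [m] := ubnP #|A|.
elim: m A => // m IHm A /ltnSE le_Am le_AN.
have [A0|A_gt0] := posnP #|A|.
  by rewrite A0 weight_sum0 // mulr1 (cards0_eq A0) card_rankings0.
have s0 : 0%N \notin s by apply/negP=> /(allP s_gt0).
rewrite card_rankings_rec ?A_gt0 // natr_sum sum_card_mem //.
rewrite weight_sum_rec ?A_gt0 // mulr_sumr [RHS]big_mkcond.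
apply: eq_big_seq => k ks; have k_gt0 := allP s_gt0 k ks.
have cardD (B : {set T}) : B \subset A -> #|A :\: B| = (#|A| - #|B|)%N.
  by move=> sBA; rewrite cardsD (setIidPr sBA).
under eq_bigr => B /andP[sBA /eqP Bk].
  rewrite IHm ?cardD ?Bk //; first over.
    by rewrite (leq_trans _ le_Am) // ltn_subrL k_gt0.
  by rewrite (leq_trans (leq_subr _ _)).
rewrite sumr_const.
have -> : #|[pred B : {set T} | (B \subset A) && (#|B| == k)]| = 'C(#|A|, k).
  by rewrite -(cards_draws A k); apply: eq_card => B; rewrite !inE.
case: leqP => [le_kA|lt_Ak]; last by rewrite bin_small.
(* The number of blocks of size [k] times the factorial of [#|A| - k] is the factorial of [#|A|]
   over that of [k]. *)
rewrite -(bin_fact le_kA) !natrM -[LHS]mulr_natl !mulrA.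
congr (_ * _); rewrite -[RHS]mulrA -[RHS]mulrA; congr (_ * _).
by rewrite mulrC divfK ?fact_neq0.
Qed.

(** The integer division in [multinomial] is exact, so it agrees with division in [rat]. *)
Lemma multinomial_tupleE (n j : nat) (c : j.-tuple 'I_n) :
  (multinomial (map val c))%:R =
  (\sum_i tnth c i)%N`!%:R / \prod_i (tnth c i)`!%:R :> rat.
Proof.
have -> : (\sum_i tnth c i)%N = sumn (map val c).
  by rewrite sumnE big_map big_tuple.
rewrite -multinomialE natrM big_map big_tuple natr_prod mulfK //.
by apply/prodf_neq0 => i _; apply: fact_neq0.
Qed.

Theorem theorem4p4 (n : nat) (j : nat) (s : j.-tuple nat)
    (n_gt0 : (0 < n)%N) (s_uniq : uniq s)
    (s_gt0 : all (fun x => 0 < x)%N s) :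
  #|FR_T2 n (mem s)|%:R =
    n`!%:R * \sum_(c in weighted_solutions n s)
      (multinomial (map val c))%:R *
      \prod_(i < j) (tnth s i)`!%:R ^- tnth c i :> rat.
Proof.
rewrite card_FR_T2 // card_rankings ?cardsT ?card_ord //; congr (_ * _).
rewrite /weight_sum (reindex_onto
  (fun c : j.-tuple 'I_n.+1 => [ffun i => tnth c i])
  (fun f : {ffun 'I_j -> 'I_n.+1} => [tuple f i | i < j])) /=; last first.
  by move=> f _; apply/ffunP=> i; rewrite ffunE tnth_mktuple.
apply: eq_big => [c|c _].
  rewrite inE; under eq_bigr do rewrite ffunE.
  by rewrite andb_idr // => _; apply/eqP/eq_from_tnth => i; rewrite tnth_mktuple ffunE.
rewrite (@eq_weight _ _ _ (fun i => tnth c i)) => [|i]; last by rewrite ffunE.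
rewrite multinomial_tupleE /weight -mulrA -prodfV -big_split /=; congr (_ * _).
by apply: eq_bigr => i _; rewrite invfM.
Qed.
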